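(* Let $A$ be a Boolean algebra. There exists a coherent finite-separation map $s\colon A^{+}\to[A^{+}]^{<\omega}$ on the positive cone $A^{+}=A\setminus\{0\}$ if and only if $A$ is countable.
   Context: Boolean algebras are written $(A,\vee,\wedge,-,0,1)$; ''countable'' includes finite. $[X]^{<\omega}$ is the set of finite subsets of $X$. For a finite $F\subseteq A$ put $F^{\wedge}=\{\bigwedge G:\emptyset\neq G\subseteq F\}\setminus\{0\}$. A map $s\colon A^{+}\to[A^{+}]^{<\omega}$ is a finite-separation map if for all $a,b\in A^{+}$ with $a\wedge b=0$ there are $c,d\in s(a)\cap s(b)$ with $c\wedge d=0$, $a\leqslant c$ and $b\leqslant d$. It is coherent if, in addition, $s(a\wedge b)\subseteq (s(a)\cup s(b))^{\wedge}$ for all $a,b\in A^{+}$ with $a\wedge b>0$. *)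

(* Defs.v *)
From mathcomp Require Import all_boot all_order.
From mathcomp Require Import finmap.

Set Implicit Arguments.
Unset Strict Implicit.
Unset Printing Implicit Defensive.

Import Order.Theory.

Local Open Scope order_scope.
Local Open Scope fset_scope.

(* Boolean algebras are the complemented bounded distributive lattices
   [ctbDistrLatticeType]; the trivial algebra, where \bot = \top, is allowed. *)

Definition positive_cone (d : Order.disp_t) (A : ctbDistrLatticeType d) :=
  {x : A | x != \bot}.

(* F^wedge, the nonzero meets of nonempty subsets of F. *)
Definition meet_closure (d : Order.disp_t) (A : ctbDistrLatticeType d)
    (F : {fset A}) : {fset A} :=
  [fset \meet_(x <- G) x | G : {fset A} in fpowerset F `\ fset0]%O `\ \bot.

Definition finite_separation_map (d : Order.disp_t)
    (A : ctbDistrLatticeType d)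
    (s : positive_cone A -> {fset positive_cone A}) : Prop :=
  forall a b : positive_cone A, (val a `&` val b)%O = \bot ->
  exists c e : positive_cone A,
    [/\ c \in s a `&` s b, e \in s a `&` s b,
        (val c `&` val e)%O = \bot, val a <= val c & val b <= val e].

Definition coherent_finite_separation_map (d : Order.disp_t)
    (A : ctbDistrLatticeType d)
    (s : positive_cone A -> {fset positive_cone A}) : Prop :=
  finite_separation_map s /\
  forall (a b : positive_cone A) (ab : (val a `&` val b)%O != \bot),
    [fset val x | x in s (exist _ (val a `&` val b)%O ab)]
      `<=` meet_closure [fset val x | x in s a `|` s b].

(* Main.v *)
Require Import Defs.
From mathcomp Require Import all_boot all_order.
From mathcomp Require Import finmap.
From mathcomp Require Import boolp classical_sets cardinality.

(* If [s] is coherent, separating [a `&` b] from its complement puts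
   [~` (a `&` b)] in [s (a `&` b)], so coherence writes [a `&` b] as
   [p `|` q] with [p] and [q] in finite sets [t a] and [t b].  Let [M] be a
   countable subalgebra closed under [t] and under splitting of elements that
   are not atoms of [A].  Every [a] has a largest element [j] of [M] below it,
   and likewise [j'] below [~` a]; put [k = ~` (j `|` j')].  For [e <= k] in
   [M] the part of [a `&` e] taken from [t e] lies in [M], below [a] and [k],
   so it vanishes and [a `&` e] is in the finite set [t a].  If [k] is nonzero,
   then no nonzero [e <= k] in [M] is an atom, because [a] cuts it, and
   splitting repeatedly gives infinitely many values [a `&` e].  Hence [k] is
   zero, [a = j] belongs to [M], and the algebra is [M].

   Conversely, write a countable algebra as an increasing union of finite
   subalgebras and let [s a] be the positive cone of the first one
   containing [a]. *)

Set Implicit Arguments.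
Unset Strict Implicit.
Unset Printing Implicit Defensive.

Import Order.Theory.

Local Open Scope order_scope.

Lemma count_lt (T : eqType) (a b : pred T) (s : seq T) (x : T) :
  subpred a b -> x \in s -> b x -> ~~ a x -> (count a s < count b s)%N.
Proof.
move=> ab sx bx ax; elim: s sx => //= y s IHs; rewrite in_cons.
case/orP=> [/eqP <-|sx]; last first.
  by rewrite -addnS leq_add ?IHs //; case: (a y) (ab y) => // ->.
by rewrite bx (negPf ax) ltnS sub_count.
Qed.

(** * Closed subsets exhaust the algebra *)

Section ClosedSubset.

Context (d : Order.disp_t) (A : ctbDistrLatticeType d).

(** If each entry of [l] meets some element of [I], the join of these finitely many witnesses stays
    in [I] and meets every entry. *)
Lemma avoid_directed (I : A -> Prop) (l : seq A) :
  I \bot -> (forall i j, I i -> I j -> I (i `|` j)) ->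
  (exists2 p, p \in l & forall i, I i -> p `&` i = \bot) \/
  (exists2 i, I i & forall p, p \in l -> p `&` i <> \bot).
Proof.
move=> I0 IU; elim: l => [|p l IHl]; first by right; exists \bot.
have [pI|] := EM (forall i, I i -> p `&` i = \bot).
  by left; exists p; rewrite ?mem_head.
case/existsNP=> i /not_implyP[Ii pi].
have [[q lq qI]|[j Ij lj]] := IHl.
  by left; exists q; rewrite // in_cons lq orbT.
right; exists (i `|` j); first exact: IU.
move=> q; rewrite in_cons meetUr => /orP[/eqP->|lq] /eqP; rewrite join_eq0.
  by case/andP=> /eqP.
by case/andP=> _ /eqP; apply: lj.
Qed.

Variables (t : A -> seq A) (M : A -> Prop).
Hypothesis meet_split : forall a b,
  exists p q, [/\ p \in t a, q \in t b & a `&` b = p `|` q].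
Hypothesis M0 : M \bot.
Hypothesis MI : forall a b, M a -> M b -> M (a `&` b).
Hypothesis MC : forall a, M a -> M (~` a).
Hypothesis Mt : forall a p, M a -> p \in t a -> M p.
Hypothesis Msplit : forall a, M a ->
  (exists b, \bot < b < a) -> exists2 b, M b & \bot < b < a.

Let MU a b : M a -> M b -> M (a `|` b).
Proof. by move=> Ma Mb; rewrite -[_ `|` _]complK complU; auto. Qed.

(* Removing from [a] an element [i <= a] of [M] leaves [p] joined with an
   element of [M], where [p] takes finitely many values; as these [i] are
   directed, one value of [p] serves them all. *)
Lemma lower_projection (a : A) :
  exists2 j, M j /\ j <= a & forall i, M i -> i <= a -> i <= j.
Proof.
pose I i := M i /\ i <= a.
have IU i j : I i -> I j -> I (i `|` j).
  by case=> Mi ia [Mj ja]; split; [exact: MU | rewrite leUx ia].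
pose l := [seq p <- t a | `[< exists2 j, I j & a = p `|` j >]].
have I0 : I \bot by split; rewrite ?le0x.
have [[p]|[i [Mi ia] li]] := avoid_directed l I0 IU.
  rewrite mem_filter => /andP[/asboolP[j [Mj ja] ap] _] pI.
  exists j => // i Mi ia.
  have : i `&` a = i by apply/eqP; rewrite -leEmeet.
  by rewrite ap meetUr [i `&` p]meetC pI ?join0x // => <-; rewrite leIr.
(* Here [i] in [I] meets all of [l]. The part of [a] outside [i] is the join of [p] and [q], so [a]
   is the join of [p], [q] and [i]. This puts [p] in [l], yet [p] is disjoint from [i]. *)
have [p [q [tp tq ipq]]] := meet_split a (~` i).
have Mq : M q by apply: Mt tq; exact: MC.
case: (li p).
  rewrite mem_filter tp andbT; apply/asboolP; exists (q `|` i).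
    apply: IU; split=> //; apply: (@le_trans _ _ (a `&` ~` i)).
      by rewrite ipq leUr.
    exact: leIl.
  by rewrite joinA -ipq joinIl [~` i `|` i]joinC joinxC meetx1; apply/esym/join_l.
apply/eqP; rewrite disj_leC; apply: (@le_trans _ _ (a `&` ~` i)).
  by rewrite ipq leUl.
exact: leIr.
Qed.

Lemma closed_subset_full (a : A) : M a.
Proof.
have [j [Mj ja] jmax] := lower_projection a.
have [j' [Mj' ja'] jmax'] := lower_projection (~` a).
pose k := ~` (j `|` j').
have Mk : M k by apply/MC/MU.
have low e : M e -> e <= k -> e <= a -> e = \bot.
  move=> Me ek ea; apply/eqP; rewrite -[e]meetxx disj_leC.
  by apply: (le_trans ek); rewrite leC (le_trans (jmax _ Me ea)) ?leUl.
have high e : M e -> e <= k -> a `&` e = \bot -> e = \bot.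
  move=> Me ek /eqP; rewrite meetC disj_leC => ea.
  apply/eqP; rewrite -[e]meetxx disj_leC.
  by apply: (le_trans ek); rewrite leC (le_trans (jmax' _ Me ea)) ?leUr.
have ta e : M e -> e <= k -> a `&` e \in t a.
  move=> Me ek; have [p [q [tp tq epq]]] := meet_split a e.
  have qae : q <= a `&` e by rewrite epq leUr.
  move: qae; rewrite lexI => /andP[qa qe].
  by rewrite epq (low q (Mt Me tq) (le_trans qe ek) qa) joinx0.
(* Induction on the number of entries of [t a] below the meet of [a] and [e]. That meet is itself
   such an entry, and it is lost on passing to a suitable [y < e]. *)
have noe n : forall e, M e -> e <= k -> e != \bot ->
    (count (fun p => (p <= a `&` e)%O) (t a) <= n)%N -> False.
  elim: n => [|n IHn] e Me ek e0 len.
    move: len; rewrite leqn0 => /eqP cnt0.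
    have : has (fun p => p <= a `&` e) (t a).
      by apply/hasP; exists (a `&` e); rewrite ?ta.
    by rewrite has_count cnt0.
  have [|y My /andP[y0 ye]] := Msplit Me.
    exists (a `&` e); apply/andP; split.
      by rewrite lt0x; apply/eqP => /(high _ Me ek)/eqP; rewrite (negPf e0).
    rewrite lt_neqAle leIr andbT; apply/eqP => aee; case/eqP: e0.
    by apply: low => //; rewrite -aee leIl.
  have yk : y <= k := le_trans (ltW ye) ek.
  apply: (IHn y) => //; first by rewrite -lt0x.
  rewrite -ltnS; apply: leq_trans len.
  have sub p : p <= a `&` y -> p <= a `&` e.
    by move/le_trans; apply; rewrite leI2 // ltW.
  (* Otherwise the part of [e] outside [y] would miss [a] and vanish by [high]. *)
  have nle : ~~ (a `&` e <= a `&` y).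
    apply/negP => le; have e_le_y : e `&` ~` y = \bot.
      apply: high; [by auto | by rewrite (le_trans (leIl _ _)) |].
      apply/eqP; rewrite meetA disj_leC complK.
      exact: le_trans le (leIr _ _).
    by move: ye; rewrite lt_leAnge -{2}[y]complK -disj_leC e_le_y eqxx andbF.
  exact: count_lt sub (ta e Me ek) (lexx _) nle.
have k0 : k = \bot by apply/eqP/negPn/negP => /(noe _ _ Mk (lexx _)); apply.
have aj : a <= j.
  have: j `|` j' = \top by rewrite -[_ `|` _]complK -/k k0 compl0.
  move=> jj; rewrite -[a]meetx1 -jj meetUr leUx leIr /=.
  by move: ja'; rewrite lexC -disj_leC => /eqP->; rewrite le0x.
by rewrite (_ : a = j) //; apply/eqP; rewrite eq_le aj.
Qed.

End ClosedSubset.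

(** * Countability from a coherent map *)

Section Countability.

Context (d : Order.disp_t) (A : ctbDistrLatticeType d).

(** Terms over a one-point type form a countable type. Label [n.+3] selects entry [n] of a list
    given by [t]; leaves and ill-formed trees denote [\bot]. *)
Fixpoint eval_closure (split : A -> A) (t : A -> seq A)
    (u : GenTree.tree unit) : A :=
  match u with
  | GenTree.Node 0 [:: v; w] => eval_closure split t v `&` eval_closure split t w
  | GenTree.Node 1 [:: v] => ~` eval_closure split t v
  | GenTree.Node 2 [:: v] => split (eval_closure split t v)
  | GenTree.Node n.+3 [:: v] => nth \bot (t (eval_closure split t v)) n
  | _ => \bot
  end.

Lemma meet_split_countable (t : A -> seq A) :
  (forall a b, exists p q, [/\ p \in t a, q \in t b & a `&` b = p `|` q]) ->
  countable [set: A]%classic.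
Proof.
move=> tI; pose split a := xget \bot [set b : A | \bot < b < a]%classic.
pose ev := eval_closure split t; pose M a := exists u, ev u = a.
have full : forall a, M a.
  apply: (closed_subset_full tI).
  - by exists (GenTree.Leaf tt).
  - by move=> _ _ [u <-] [v <-]; exists (GenTree.Node 0 [:: u; v]).
  - by move=> _ [u <-]; exists (GenTree.Node 1 [:: u]).
  - move=> _ p [u <-] tp.
    by exists (GenTree.Node (index p (t (ev u))).+3 [:: u]); apply: nth_index.
  - move=> _ [u <-] /(xgetPex \bot) split_u; exists (split (ev u)) => //.
    by exists (GenTree.Node 2 [:: u]).
pose code a := xget (GenTree.Leaf tt) [set u | ev u = a]%classic.
have codeK a : ev (code a) = a by apply: xgetPex (full a).
apply/countable_injP; exists (fun a => choice.pickle (code a)) => a b _ _ eq_ab.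
by rewrite -[a]codeK -[b]codeK (pcan_inj choice.pickleK eq_ab).
Qed.

(** By De Morgan, cutting [G] in two makes the complement of its meet a join of two such entries; an
    empty half contributes [\bot]. *)
Definition complemented_meets (F : {fset A}) : seq A :=
  [seq ~` \meet_(x <- (G : {fset A})) x | G <- fpowerset F].

Lemma complemented_meetsP (F G : {fset A}) :
  (G `<=` F)%fset -> ~` \meet_(x <- G) x \in complemented_meets F.
Proof. by move=> sGF; apply: map_f; rewrite fpowersetE. Qed.

Lemma coherent_countable (s : positive_cone A -> {fset positive_cone A}) :
  coherent_finite_separation_map s -> countable [set: A]%classic.
Proof.
case=> sep coh.
pose S (a : positive_cone A) : {fset A} := [fset val x | x in s a]%fset.
(* The entries [\bot] and [a] serve meets equal to [\bot] or [\top], where one of the two elements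
   to separate is not positive. *)
pose t a := \bot :: a ::
  if insub a is Some u then complemented_meets (S u) else [::].
apply: (@meet_split_countable t) => a b.
have tbot x : \bot \in t x by rewrite mem_head.
have tself x : x \in t x by rewrite !in_cons eqxx orbT.
have [ab0|ab0] := eqVneq (a `&` b) \bot.
  by exists \bot, \bot; rewrite joinx0.
have [ab1|ab1] := eqVneq (~` (a `&` b)) \bot.
  have abt : a `&` b = \top by rewrite -[LHS]complK ab1 compl0.
  have at1 : a = \top by apply/eqP; rewrite -le1x -abt leIl.
  by exists a, \bot; split; rewrite // joinx0 abt.
have a0 : a != \bot by apply: contraNneq ab0 => ->; rewrite meet0x.
have b0 : b != \bot by apply: contraNneq ab0 => ->; rewrite meetx0.
pose ua : positive_cone A := exist _ a a0.
pose ub : positive_cone A := exist _ b b0.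
pose uc : positive_cone A := exist _ (a `&` b) ab0.
pose ud : positive_cone A := exist _ (~` (a `&` b)) ab1.
have [c [e []]] := sep uc ud (meetxC _).
rewrite !in_fsetI => _ /andP[se _] /eqP.
rewrite disj_leC /= => ce le_c le_e.
(* [c] dominates the meet and is disjoint from [e], which bounds [e] from above. *)
have eE : val e = ~` (a `&` b).
  apply/eqP; rewrite eq_le le_e andbT lexC; exact: le_trans le_c ce.
have /(fsubsetP (coh ua ub ab0)) : ~` (a `&` b) \in S uc.
  by apply/imfsetP; exists e.
rewrite /meet_closure in_fsetD1 => /andP[_ /imfsetP[G /=]].
rewrite in_fsetD1 fpowersetE => /andP[_ /fsubsetP sG] abE.
(* Members of [G] outside [S ua] come from [s ub]. *)
exists (~` \meet_(x <- [fset x in G | x \in S ua]%fset) x).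
exists (~` \meet_(x <- [fset x in G | x \notin S ua]%fset) x).
rewrite -complI -big_fsetID -abE complK; split=> //.
- rewrite !in_cons /t insubT /= complemented_meetsP ?orbT //.
  by apply/fsubsetP=> x; rewrite !inE => /andP[].
- rewrite !in_cons /t insubT /= complemented_meetsP ?orbT //.
  apply/fsubsetP=> x; rewrite !inE /= => /andP[/sG /imfsetP[y /=]].
  rewrite in_fsetU => /orP[sy ->|sy -> _]; last by apply/imfsetP; exists y.
  by move/negP; case; apply/imfsetP; exists y.
Qed.

(** * Finite subalgebras and the converse *)

Definition mux (g x y : A) : A := (x `&` g) `|` (y `&` ~` g).

Lemma muxI g x y x' y' :
  mux g x y `&` mux g x' y' = mux g (x `&` x') (y `&` y').
Proof.
have cross u v : (u `&` g) `&` (v `&` ~` g) = \bot.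
  by rewrite meetACA meetxC meetx0.
rewrite /mux meetUr !meetUl cross [_ `&` ~` g `&` _]meetC cross joinx0 join0x.
by rewrite meetACA meetxx [X in _ `|` X]meetACA meetxx.
Qed.

Lemma muxxx g x : mux g x x = x.
Proof. by rewrite /mux -meetUr joinxC meetx1. Qed.

Lemma muxU g x y x' y' :
  mux g x y `|` mux g x' y' = mux g (x `|` x') (y `|` y').
Proof. by rewrite /mux joinACA -!meetUl. Qed.

Lemma muxC g x y : ~` mux g x y = mux g (~` x) (~` y).
Proof.
have cover : mux g x y `|` mux g (~` x) (~` y) = \top.
  by rewrite muxU !joinxC muxxx.
apply/eqP; rewrite eq_le; apply/andP; split.
  by rewrite -[X in X <= _]meetx1 -cover meetUr meetC meetxC join0x leIr.
by rewrite -disj_leC muxI ![~` _ `&` _]meetC !meetxC muxxx.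
Qed.

(** Adjoining [g m] to a subalgebra yields exactly the elements agreeing with one old element below
    [g m] and with another outside it, so every stage stays finite. *)
Fixpoint generated_subalgebra (g : nat -> A) (n : nat) : {fset A} :=
  if n is m.+1 then
    [fset mux (g m) x y | x in generated_subalgebra g m,
                          y in generated_subalgebra g m]%fset
  else [fset \bot; \top]%fset.

Lemma generated_subalgebra_le g m n : (m <= n)%N ->
  (generated_subalgebra g m `<=` generated_subalgebra g n)%fset.
Proof.
elim: n => [|n IHn]; first by rewrite leqn0 => /eqP->.
rewrite leq_eqVlt => /orP[/eqP->//|/IHn/fsubset_trans]; apply.
by apply/fsubsetP => x xn; apply/imfset2P; exists x => //; exists x; rewrite ?muxxx.
Qed.

Lemma generated_subalgebraC g n x :
  x \in generated_subalgebra g n -> ~` x \in generated_subalgebra g n.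
Proof.
elim: n x => [|n IHn] x /=.
  by rewrite !inE => /orP[]/eqP->; rewrite ?compl0 ?compl1 eqxx ?orbT.
move=> /imfset2P[y yn [z zn ->]]; apply/imfset2P.
by exists (~` y); [exact: IHn | exists (~` z); [exact: IHn | rewrite muxC]].
Qed.

Lemma generated_subalgebraI g n x y :
  x \in generated_subalgebra g n -> y \in generated_subalgebra g n ->
  x `&` y \in generated_subalgebra g n.
Proof.
elim: n x y => [|n IHn] x y /=.
  by rewrite !inE => /orP[]/eqP-> /orP[]/eqP->; rewrite ?meet0x ?meet1x eqxx ?orbT.
move=> /imfset2P[x1 x1n [x2 x2n ->]] /imfset2P[y1 y1n [y2 y2n ->]].
rewrite muxI; apply/imfset2P.
by exists (x1 `&` y1); [exact: IHn | exists (x2 `&` y2); [exact: IHn|]].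
Qed.

Lemma generated_subalgebra_gen g n : g n \in generated_subalgebra g n.+1.
Proof.
have /fsubsetP sub := generated_subalgebra_le g (leq0n n).
have b0 : \bot \in generated_subalgebra g n by rewrite sub // !inE eqxx.
have b1 : \top \in generated_subalgebra g n by rewrite sub // !inE eqxx orbT.
apply/imfset2P; exists \top => //; exists \bot => //.
by rewrite /mux meet1x meet0x joinx0.
Qed.

Lemma countable_coherent : countable [set: A]%classic ->
  exists s : positive_cone A -> {fset positive_cone A},
    coherent_finite_separation_map s.
Proof.
move=> /countable_injP[f f_inj].
(* A left inverse of [f], with value [\bot] off its range, hence an enumeration of [A]. *)
pose g n := xget \bot [set a : A | f a = n]%classic.
have gf a : g (f a) = a.
  apply: f_inj; rewrite ?inE //.
  by apply: (xgetPex \bot (P := fun b => f b = f a)); exists a.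
pose B := generated_subalgebra g.
have exB a : exists n, a \in B n.
  by exists (f a).+1; rewrite -{1}[a]gf generated_subalgebra_gen.
pose rk a := ex_minn (exB a).
have rkB a n : (a \in B n) = (rk a <= n)%N.
  rewrite /rk; case: ex_minnP => m am mmin; apply/idP/idP => [/mmin//|mn].
  exact: (fsubsetP (generated_subalgebra_le g mn)).
have rkC a : (rk (~` a) <= rk a)%N.
  by rewrite -rkB generated_subalgebraC // [_ \in _]rkB.
have rkI a b : (rk (a `&` b) <= maxn (rk a) (rk b))%N.
  by rewrite -rkB generated_subalgebraI // [_ \in _]rkB ?leq_maxl ?leq_maxr.
pose s (a : positive_cone A) : {fset positive_cone A} :=
  [fset x in pmap insub (B (rk (val a)))]%fset.
have in_s a x : (x \in s a) = (rk (val x) <= rk (val a))%N.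
  by rewrite inE /= mem_pmap_sub rkB.
exists s; split=> [a b ab0|a b ab].
  have Ca : ~` val a != \bot.
    apply: contraNneq (valP b) => ca0; move/eqP: ab0.
    by rewrite meetC disj_leC ca0 lex0.
  have Cb : ~` val b != \bot.
    apply: contraNneq (valP a) => cb0; move/eqP: ab0.
    by rewrite disj_leC cb0 lex0.
  (* The element of smaller rank and its complement separate the pair. *)
  have [le_ab|/ltnW le_ba] := leqP (rk (val a)) (rk (val b)).
    exists a, (exist _ (~` val a) Ca); rewrite !in_fsetI !in_s /= leqnn le_ab rkC.
    by rewrite (leq_trans (rkC _)) // meetxC lexx -disj_leC meetC ab0 eqxx.
  exists (exist _ (~` val b) Cb), b; rewrite !in_fsetI !in_s /= leqnn le_ba rkC.
  by rewrite (leq_trans (rkC _)) // meetC meetxC lexx -disj_leC ab0 eqxx.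
apply/fsubsetP => _ /imfsetP[x /= sx ->].
rewrite in_fsetD1 (valP x) /=; apply/imfsetP.
(* By [rkI], [x] already lies in [s a] or [s b], so a one-element set suffices. *)
exists [fset val x]%fset; rewrite /= ?big_seq_fset1 // in_fsetD1 fpowersetE.
rewrite fsub1set; apply/andP; split.
  by apply/eqP => /fsetP/(_ (val x)); rewrite !inE eqxx.
apply/imfsetP; exists x => //=; move: sx.
by rewrite in_fsetU !in_s -leq_max => /leq_trans; apply; apply: rkI.
Qed.

End Countability.

Theorem theoremC (d : Order.disp_t) (A : ctbDistrLatticeType d) :
  (exists s : positive_cone A -> {fset positive_cone A},
     coherent_finite_separation_map s) <->
  countable [set: A]%classic.
Proof. by split=> [[s]|]; [exact: coherent_countable | exact: countable_coherent]. Qed.
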